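(* Let $G$ be a finite group such that $\alpha(G)\ge 5/6=\alpha(S_3)$. Then one of the following holds: (1) $G\cong {C_2}^n\times S_3$ for some $n\ge 0$ and $\alpha(G)=5/6$; (2) $G\cong {C_2}^n\times D_8$ for some $n\ge 0$ and $\alpha(G)=7/8$; (3) $G\cong {C_2}^n$ for some $n\ge 0$ and $\alpha(G)=1$.
   Context: For a finite group $H$, $c(H)$ denotes the number of cyclic subgroups of $H$ (including the trivial one) and $\alpha(H):=c(H)/|H|$. $S_3$ is the symmetric group of degree $3$, $D_8$ is the dihedral group of order $8$, $C_2$ is the cyclic group of order $2$, and ${C_2}^n$ is the direct product of $n$ copies of $C_2$. *)

(* Defs.v *)
From mathcomp Require Import all_boot all_order all_fingroup all_solvable all_algebra.

Set Implicit Arguments.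
Unset Strict Implicit.
Unset Printing Implicit Defensive.

Import GroupScope GRing.Theory Num.Theory.

Definition num_cyclic (gT : finGroupType) (G : {group gT}) : nat :=
  #|[set H : {group gT} in subgroups G | cyclic H]|.

Definition alpha (gT : finGroupType) (G : {group gT}) : rat :=
  ((num_cyclic G)%:R / #|G|%:R)%R.

(* The group law of 'Z_2 is its addition, so this is the external direct   *)
(* product of n copies of C_2; it is trivial for n = 0.                     *)
Definition C2pow (n : nat) : finGroupType :=
  {dffun forall _ : 'I_n, 'Z_2}.

(* Main.v *)
Require Import Defs.
From mathcomp Require Import all_boot all_order all_fingroup all_solvable all_algebra.
From mathcomp Require Import zify.

(** Write [S] for ['Ldiv_2(G)], the set of the solutions of [g ^+ 2 = 1] in [G].
    A cyclic group [H] has [totient #|H|] generators, so [G] is the disjoint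
    union of these sets of generators, and [S] is the union of those that have
    a single element. Since [totient] is at least 2 on the other cyclic groups,
    [2 * c(G) <= #|S| + #|G|] ([num_cyclic_le]), with equality when no element
    of [G] generates a group with more than two generators ([num_cyclic_eq]).
    Thus [alpha G >= 5/6] forces [#|S| >= 2/3 #|G|], and what remains is to
    determine the groups with that many involutions.

    If [x], [y] and [x * y] are in [S] then [x] and [y] commute. Hence
    [S :&: x *: S] lies in ['C_G[x]] for [x] in [S], and counting gives
    [2 * #|S| <= #|G| + #|'C_G[x]|] ([Ldiv2_card_cent1]): every centraliser of
    an element of [S] has index at most 3. Three cases arise.

    - All of [S] is central. As [S] generates [G], the group is elementary
      abelian.
    - Some [C = 'C_G[x]] has index 3 ([cent1_index3]). All the inequalities
      above are equalities, so [C] lies in [S] and is elementary abelian. A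
      suitable conjugate [y] of [x] lies outside [C]; as [x] has only three
      conjugates, [x ^ y = y ^ x], so [x * y] has order 3 and [x], [y] generate
      a copy of [S_3]. The group [Z = 'C_C[y]] is central of index 6, and [G]
      is the direct product of [Z] and [<<[set x; y]>>].
    - All the indices are at most 2, and some [C = 'C_G[x]] has index 2
      ([cent1_index2]). At most half of [G :\: C] lies in [S], which leaves
      more than 3/4 of [C] in [S], so [C] is elementary abelian
      ([Ldiv2_abelem]). For [y] in [S :\: C], the group [Z = 'C_C[y]] is central
      of index 4, [z = (x * y) ^+ 2] is a nontrivial element of it, and
      [x], [y] generate a copy of [D_8] that meets [Z] in [<[z]>]. A complement
      of [<[z]>] in [Z] is a direct factor of [G].

    In the second case the hypothesis [alpha G >= 5/6] meets the upper bound
    that [#|S|] gives; in the other two cases [alpha G] comes from the equality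
    case of the first bound. *)

Set Implicit Arguments.
Unset Strict Implicit.
Unset Printing Implicit Defensive.

Import GroupScope GRing.Theory Num.Theory.

(** [lia] compares cardinals syntactically, so the goal's cardinals are first
    abstracted up to conversion. *)
Ltac card_lia := repeat (let n := fresh in move: #|_| => n); clear; lia.

(** * Counting cyclic subgroups by their generators *)

(** The units 1 and [n.-1] modulo [n] are distinct once [n] exceeds 2. *)
Lemma totient_le1 n : 0 < n -> (totient n <= 1) = (n <= 2).
Proof.
move=> n0; apply/idP/idP => [|n2]; last by case: n n0 n2 => [|[|[|]]].
apply: contraTT; rewrite -!ltnNge => n3.
rewrite totient_count_coprime big_mkord.
have n1 : 1 < n by lia.
have nm : n.-1 < n by lia.
rewrite (bigD1 (Ordinal n1)) //= coprimen1.
rewrite (bigD1 (Ordinal nm)) /=; last by rewrite -val_eqE /=; lia.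
by rewrite coprimenP; lia.
Qed.

Section CyclicCount.
Variables (gT : finGroupType) (G : {group gT}).

Let cyclics := [set H : {group gT} in subgroups G | cyclic H].

(** [totient #|H|] counts the generators of [H], and each element of [G]
    generates exactly one cyclic subgroup. *)
Lemma sum_cyclic_totient (P : pred {group gT}) :
  \sum_(H in cyclics | P H) totient #|H| = #|[set x in G | P <[x]>%G]|.
Proof.
rewrite -sum1dep_card (partition_big (fun x => <[x]>%G)
  (fun H => (H \in cyclics) && P H)) /=; last first.
  by move=> x /andP[Gx Px]; rewrite !inE cycle_cyclic cycle_subG Gx Px.
apply: eq_bigr => H /andP[]; rewrite !inE => /andP[sHG /cyclicP[a Ha]] PH.
rewrite Ha -orderE totient_gen -sum1_card; apply: eq_bigl => x.
rewrite inE /generator -Ha; apply/idP/idP.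
  move=> /eqP HH; have -> : <[x]>%G = H by apply: val_inj.
  by rewrite PH eqxx !andbT -cycle_subG -HH.
by case/andP=> _ /eqP <-.
Qed.

Lemma card_Ldiv2_sum :
  #|'Ldiv_2(G)| = \sum_(H in cyclics | totient #|H| <= 1) totient #|H|.
Proof.
rewrite sum_cyclic_totient; apply: eq_card => x.
rewrite !inE -orderE totient_le1 // -order_dvdn; congr (_ && _).
by have := order_gt0 x; case: #[x] => [|[|[|n]]].
Qed.

Lemma card_sum_totient : #|G| = \sum_(H in cyclics) totient #|H|.
Proof.
have := sum_cyclic_totient predT; rewrite big_mkcondr /= => ->.
by apply: eq_card => x; rewrite inE andbT.
Qed.

Lemma num_cyclic_sum : (2 * num_cyclic G)%N = \sum_(H in cyclics) 2.
Proof. by rewrite sum_nat_const mulnC. Qed.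

(** A cyclic subgroup [H] contributes [totient #|H|] to [#|G|], and 1 to
    [#|'Ldiv_2(G)|] exactly when [totient #|H|] is 1: at least 2 in all. *)
Lemma num_cyclic_le : (2 * num_cyclic G <= #|'Ldiv_2(G)| + #|G|)%N.
Proof.
rewrite num_cyclic_sum card_Ldiv2_sum big_mkcondr card_sum_totient -big_split.
apply: leq_sum => H _ /=.
have := cardG_gt0 H; rewrite -totient_gt0.
by case: (leqP (totient #|H|) 1) => //=; lia.
Qed.

Lemma num_cyclic_eq : {in G, forall x, totient #[x] <= 2} ->
  (2 * num_cyclic G = #|'Ldiv_2(G)| + #|G|)%N.
Proof.
move=> phi2; rewrite num_cyclic_sum card_Ldiv2_sum big_mkcondr card_sum_totient.
rewrite -big_split; apply: eq_bigr => H /=.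
rewrite !inE => /andP[sHG /cyclicP[a Ha]].
have := phi2 a; rewrite -cycle_subG -Ha orderE -Ha => /(_ sHG).
have := cardG_gt0 H; rewrite -totient_gt0.
by case: (leqP (totient #|H|) 1) => //=; lia.
Qed.

End CyclicCount.

Lemma totient_order_le2 (gT : finGroupType) (g : gT) n :
  0 < n -> all (fun d => totient d <= 2) (divisors n) -> g ^+ n = 1 ->
  totient #[g] <= 2.
Proof.
by move=> n0 /allP tot gn; apply: tot; rewrite -dvdn_divisors // order_dvdn gn.
Qed.

Lemma alpha_eq (gT : finGroupType) (G : {group gT}) (a b : nat) :
  (0 < b)%N -> (b * num_cyclic G = a * #|G|)%N -> alpha G = (a%:R / b%:R)%R.
Proof.
move=> b0 E; apply/eqP; rewrite /alpha eqr_div ?pnatr_eq0 -?lt0n ?cardG_gt0 //.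
by rewrite -!natrM eqr_nat mulnC E.
Qed.

Lemma alpha_ge (gT : finGroupType) (G : {group gT}) (a b : nat) :
  (0 < b)%N -> (a%:R / b%:R <= alpha G)%R -> (a * #|G| <= b * num_cyclic G)%N.
Proof.
move=> b0; rewrite /alpha ler_pdivrMr ?ltr0n // mulrAC.
by rewrite ler_pdivlMr ?ltr0n ?cardG_gt0 // -!natrM ler_nat (mulnC b).
Qed.

(** * Subgroups of small index *)

Section SmallIndex.
Variable gT : finGroupType.
Implicit Types (x : gT) (G H K : {group gT}).

Lemma card_proper_double H K x :
  K \subset H -> x \in H -> x \notin K -> (2 * #|K| <= #|H|)%N.
Proof.
move=> sKH Hx nKx; rewrite -(Lagrange sKH) mulnC leq_mul2l indexg_gt1.
by apply/orP; right; apply/subsetPn; exists x.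
Qed.

Lemma half_subG G H : H \subset G -> (#|G| < 2 * #|H|)%N -> H :=: G.
Proof.
move=> sHG ltGH; apply/eqP; rewrite eqEcard sHG -(Lagrange sHG).
have iH : #|G : H| < 2.
  by rewrite -(ltn_pmul2l (cardG_gt0 H)) Lagrange // mulnC.
by rewrite -{2}[#|H|]muln1 leq_mul2l -ltnS iH orbT.
Qed.

End SmallIndex.

(** * Groups with many solutions of g ^+ 2 = 1 *)

Section ManyInvolutions.
Variables (gT : finGroupType) (G : {group gT}).
Implicit Types x y : gT.

Lemma Ldiv2P x : reflect (x \in G /\ x^-1 = x) (x \in 'Ldiv_2(G)).
Proof.
apply: (iffP LdivP) => -[Gx xx]; split=> //.
  by apply/eqP; rewrite eq_invg_mul; apply/eqP.
by rewrite expgS expg1 -{1}xx mulVg.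
Qed.

Lemma Ldiv2_commute x y : x \in 'Ldiv_2(G) -> y \in 'Ldiv_2(G) ->
  x * y \in 'Ldiv_2(G) -> commute x y.
Proof.
move=> /Ldiv2P[_ xx] /Ldiv2P[_ yy] /Ldiv2P[_ xy].
by rewrite /commute -[LHS]xy invMg xx yy.
Qed.

Lemma Ldiv2_lcoset x : x \in 'Ldiv_2(G) ->
  'Ldiv_2(G) :&: x *: 'Ldiv_2(G) \subset 'C_G[x].
Proof.
move=> Sx; apply/subsetP=> y /setIP[Sy]; rewrite mem_lcoset.
have [Gx xx] := Ldiv2P _ Sx; rewrite xx => Sxy.
have [Gy _] := Ldiv2P _ Sy.
rewrite inE Gy; apply/cent1P.
exact: commute_sym (Ldiv2_commute Sx Sy Sxy).
Qed.

Lemma Ldiv2_card_lcoset x : x \in 'Ldiv_2(G) ->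
  (2 * #|'Ldiv_2(G)| <= #|G| + #|'Ldiv_2(G) :&: x *: 'Ldiv_2(G)|)%N.
Proof.
move=> Sx; have [Gx _] := Ldiv2P _ Sx.
rewrite mul2n -addnn -{2}(card_lcoset 'Ldiv_2(G) x) -cardsUI leq_add2r.
by rewrite subset_leq_card // subUset subsetIl mul_subG ?sub1set ?subsetIl.
Qed.

(** The translate [x *: 'Ldiv_2(G)] stays in [G] and can only meet
    ['Ldiv_2(G)] inside the centraliser of [x]. *)
Lemma Ldiv2_card_cent1 x : x \in 'Ldiv_2(G) ->
  (2 * #|'Ldiv_2(G)| <= #|G| + #|'C_G[x]|)%N.
Proof.
move=> Sx; apply: leq_trans (Ldiv2_card_lcoset Sx) _.
by rewrite leq_add2l subset_leq_card ?Ldiv2_lcoset.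
Qed.

(** In the extreme case [x *: 'Ldiv_2(G)] meets ['Ldiv_2(G)] in all of
    ['C_G[x]]. *)
Lemma Ldiv2_card_cent1_eq x : x \in 'Ldiv_2(G) ->
  (#|G| + #|'C_G[x]| <= 2 * #|'Ldiv_2(G)|)%N -> 'C_G[x] \subset 'Ldiv_2(G).
Proof.
move=> Sx leC; have eqC : 'Ldiv_2(G) :&: x *: 'Ldiv_2(G) = 'C_G[x].
  apply/eqP; rewrite eqEcard Ldiv2_lcoset //= -(leq_add2l #|G|).
  exact: leq_trans leC (Ldiv2_card_lcoset Sx).
by rewrite -eqC subsetIl.
Qed.

(** More than half of [G] generates [G], so [G] is abelian; then ['Ldiv_2(G)] is
    a subgroup, and for the same reason it is all of [G]. *)
Lemma Ldiv2_central_abelem :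
  'Ldiv_2(G) \subset 'Z(G) -> (#|G| < 2 * #|'Ldiv_2(G)|)%N -> 2.-abelem G.
Proof.
move=> SZ ltGS.
have ZG : 'Z(G) = G.
  apply: half_subG; first exact: center_sub.
  by apply: leq_trans ltGS _; rewrite leq_mul2l subset_leq_card ?orbT.
have abG : abelian G by apply/center_idP.
have SG : 'Ldiv_2(G) = G.
  exact: (half_subG (H := Group (group_Ldiv 2 abG)) (subsetIl _ _) ltGS).
by rewrite abelemE // abG -sub_Ldiv SG subxx.
Qed.

(** Beyond three quarters, [Ldiv2_card_cent1] makes each ['C_G[x]] larger than
    half of [G], so that ['Ldiv_2(G)] is central. *)
Lemma Ldiv2_abelem : (3 * #|G| < 4 * #|'Ldiv_2(G)|)%N -> 2.-abelem G.
Proof.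
move=> lt34; apply: Ldiv2_central_abelem; last by lia.
apply/subsetP=> x Sx; have [Gx _] := Ldiv2P _ Sx.
have CG : 'C_G[x] = G.
  apply: half_subG; first exact: subsetIl.
  by move: lt34 (Ldiv2_card_cent1 Sx) => /=; card_lia.
by apply/setIP; split=> //; rewrite -sub_cent1; apply/setIidPl.
Qed.

Lemma Ldiv2_order x : x \in 'Ldiv_2(G) -> x != 1 -> #[x] = 2.
Proof. by case/LdivP=> _ xx; apply: nt_prime_order. Qed.

End ManyInvolutions.

(** * Subgroups generated by two involutions *)

Section Dihedral.
Variable gT : finGroupType.
Implicit Types (x y : gT) (G C Z : {group gT}).

(** Conjugation by [x] inverts [x * y], so [<[x]>] normalises [<[x * y]>]; it
    meets it trivially, since otherwise [x] would commute with [x * y], hence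
    with [y]. *)
Lemma card_gen_involutions x y : #[x] = 2 -> #[y] = 2 ->
  x ^ y != x -> #|<<[set x; y]>>| = (2 * #[x * y])%N.
Proof.
move=> ox oy ncxy.
have xx : x^-1 = x by apply/eqP; rewrite eq_invg_mul -expg2 -ox expg_order.
have yy : y^-1 = y by apply/eqP; rewrite eq_invg_mul -expg2 -oy expg_order.
have nX : <[x]> \subset 'N(<[x * y]>).
  rewrite cycle_subG; apply/normP; rewrite -cycleJ.
  have -> : (x * y) ^ x = (x * y)^-1.
    by rewrite conjgE invMg xx yy !mulgA -{1}xx mulVg mul1g.
  by rewrite cycleV.
have nx : x \notin <[x * y]>.
  apply: contra ncxy => /cycleP[i xi]; apply/eqP.
  have cx : commute x (x * y) by rewrite {1}xi; apply/commute_sym/commuteX.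
  apply/conjg_fixP/commgP; rewrite -(mulKg x y).
  by apply: commuteM => //; apply/commuteV.
have -> : <<[set x; y]>> = <[x * y]> <*> <[x]>.
  apply/eqP; rewrite eqEsubset gen_subG !subUset !sub1set /=.
  rewrite -{2}(mulKg x y) mem_gen ?inE ?cycle_id ?orbT //=.
  rewrite groupM ?groupV ?mem_gen ?inE ?cycle_id ?orbT //= join_subG !cycle_subG.
  by rewrite groupM ?mem_gen ?inE ?eqxx ?orbT.
rewrite norm_joinEr // TI_cardMg; first by rewrite -!orderE ox mulnC.
by rewrite setIC prime_TIg ?cycle_subG // -orderE ox.
Qed.

(** The equation [x ^ y = y ^ x] is the braid relation [y * x * y = x * y * x], which for
    involutions amounts to [(x * y) ^+ 3 = 1]. *)
Lemma braid_order3 x y : #[x] = 2 -> #[y] = 2 ->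
  x ^ y = y ^ x -> x ^ y != x -> #[x * y] = 3.
Proof.
move=> ox oy braid ncxy.
have xx : x * x = 1 by rewrite -expg2 -ox expg_order.
have yy : y * y = 1 by rewrite -expg2 -oy expg_order.
have xV : x^-1 = x by apply/eqP; rewrite eq_invg_mul xx.
have yV : y^-1 = y by apply/eqP; rewrite eq_invg_mul yy.
apply: nt_prime_order => //.
  move: braid; rewrite !conjgE xV yV => braid.
  rewrite !expgS expg0 mulg1 -!mulgA braid.
  by rewrite (mulgA x x) xx mul1g (mulgA y y) yy mul1g xx.
apply: contra ncxy; rewrite -eq_invg_mul xV => /eqP->.
by rewrite conjgE mulKg.
Qed.

(** The subgroup generated by [Z], [x] and [y] contains [C], because its
    intersection with [C] exceeds [Z], and is thus larger than half of [G]. *)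
Lemma involutions_cent_mul Z C G x y :
    Z \subset C -> C \subset G -> x \in C -> x \notin Z -> y \in G -> y \notin C ->
    Z \subset 'C[x] -> Z \subset 'C[y] ->
    (#|C| <= 2 * #|Z|)%N -> (#|G| < 4 * #|C|)%N ->
  <<[set x; y]>> \subset 'C(Z) /\ Z * <<[set x; y]>> = G.
Proof.
move=> sZC sCG Cx nZx Gy nCy cZx cZy leCZ ltGC.
have cDZ : <<[set x; y]>> \subset 'C(Z).
  by rewrite gen_subG subUset !sub1set -!sub_cent1 cZx.
split=> //; rewrite -cent_joinEr //.
set M := (Z <*> <<[set x; y]>>)%G.
have Mx : x \in M by rewrite (subsetP (joing_subr _ _)) // mem_gen // !inE eqxx.
have My : y \in M.
  by rewrite (subsetP (joing_subr _ _)) // mem_gen // !inE eqxx orbT.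
have sZM : Z \subset M by exact: joing_subl.
have sMG : M \subset G.
  rewrite join_subG (subset_trans sZC) //= gen_subG subUset !sub1set Gy.
  by rewrite (subsetP sCG).
have sCM : C \subset M.
  have eqI : M :&: C = C.
    apply/eqP; rewrite eqEcard subsetIr (leq_trans leCZ) //.
    by apply: (card_proper_double (x := x)); rewrite ?subsetI ?sZM // inE Mx.
  by rewrite -eqI subsetIl.
apply: half_subG => //; apply: leq_trans ltGC _.
have := card_proper_double sCM My nCy; card_lia.
Qed.

Lemma conjg_eq_r x y : (x ^ y == y) = (x == y).
Proof. by rewrite -{2}(mulKg y y) -conjgE (inj_eq (conjg_inj y)). Qed.

End Dihedral.

(** * The symmetric group of degree 3 *)

Section Order6.
Variables (gT : finGroupType) (G : {group gT}) (x y : gT).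
Hypotheses (Gx : x \in G) (Gy : y \in G) (ox : #[x] = 2) (oy : #[y] = 2).
Hypotheses (ncxy : x ^ y != x) (oG : #|G| = 6).

Let nxy : x != y.
Proof. by apply: contraNneq ncxy => <-; rewrite conjgE mulKg. Qed.

Lemma order6_isog_D6 : G \isog [set: 'D_6].
Proof.
have sDG : <<[set x; y]>> \subset G by rewrite gen_subG subUset !sub1set Gx.
have oD : #|<<[set x; y]>>| = 6.
  have := cardSg sDG; rewrite oG card_gen_involutions // (@dvdn_pmul2l 2 _ 3) //.
  have : #[x * y] != 1%N.
    rewrite order_eq1 -eq_invg_mul; apply: contra nxy => /eqP <-.
    by rewrite eq_sym eq_invg_mul -expg2 -ox expg_order.
  have := order_gt0 (x * y).
  by case: #[x * y] => [|[|[|[|k]]]] // _ _ /dvdn_leq /(_ isT).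
have := involutions_gen_dihedral ox oy nxy; rewrite /= oD.
by have -> // : <<[set x; y]>> = G by apply/eqP; rewrite eqEcard sDG oD oG.
Qed.

(** The four solutions are 1, [x], [y] and [x ^ y]; there are no others because
    ['C_G[x]] has at most 3 elements. *)
Lemma order6_card_Ldiv2 : #|'Ldiv_2(G)| = 4.
Proof.
have Sx : x \in 'Ldiv_2(G) by apply/LdivP; rewrite -ox expg_order.
have Sy : y \in 'Ldiv_2(G) by apply/LdivP; rewrite -oy expg_order.
have Sxy : x ^ y \in 'Ldiv_2(G).
  by apply/LdivP; rewrite groupJ // -conjXg -ox expg_order conj1g.
apply/eqP; rewrite eqn_leq; apply/andP; split.
  have nCy : y \notin 'C_G[x].
    apply: contra ncxy => /setIP[_ /cent1P cxy].
    exact/eqP/conjg_fixP/commgP.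
  move: (Ldiv2_card_cent1 Sx) (card_proper_double (subsetIl G 'C[x]) Gy nCy).
  by rewrite oG; card_lia.
have : [set 1; x; y; x ^ y] \subset 'Ldiv_2(G).
  by rewrite !subUset !sub1set Sx Sy Sxy !inE group1 expg1n eqxx.
move/subset_leq_card; apply: leq_trans.
have x1 : 1 != x by rewrite eq_sym -order_gt1 ox.
have y1 : 1 != y by rewrite eq_sym -order_gt1 oy.
have xy1 : 1 != x ^ y by rewrite eq_sym conjg_eq1 eq_sym.
rewrite -!setUA !cardsU1 cards1 !inE (negPf x1) (negPf y1) (negPf xy1).
by rewrite ![_ == x ^ y]eq_sym conjg_eq_r (negPf ncxy) (negPf nxy).
Qed.

Lemma order6_alpha : alpha G = (5%:R / 6%:R)%R.
Proof.
apply: alpha_eq => //.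
have phi2 : {in G, forall g, totient #[g] <= 2}.
  by move=> g Gg; apply: (totient_order_le2 (n := 6)); rewrite // -oG expg_cardG.
by have := num_cyclic_eq phi2; rewrite order6_card_Ldiv2 oG; lia.
Qed.

End Order6.

Lemma S3_noncommuting_involutions : exists x y : 'S_3,
  [/\ #[x] = 2, #[y] = 2 & x ^ y != x].
Proof.
pose o : 'I_3 := ord0; pose i : 'I_3 := inord 1; pose j : 'I_3 := inord 2.
exists (tperm o i), (tperm i j).
have oi : o != i by rewrite -val_eqE /= inordK.
have oj : o != j by rewrite -val_eqE /= inordK.
have ij : i != j by rewrite -val_eqE /= !inordK.
split.
- apply: nt_prime_order => //; first by rewrite expg2 tperm2.
  by apply/eqP=> /permP/(_ o)/eqP; rewrite tpermL perm1 eq_sym (negPf oi).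
- apply: nt_prime_order => //; first by rewrite expg2 tperm2.
  by apply/eqP=> /permP/(_ i)/eqP; rewrite tpermL perm1 eq_sym (negPf ij).
- have -> : tperm o i ^ tperm i j = tperm o j.
    by rewrite tpermJ tpermL tpermD // eq_sym.
  apply/eqP=> /permP/(_ o); rewrite !tpermL => /esym/eqP.
  by rewrite (negPf ij).
Qed.

Lemma card_S3 : #|[set: 'S_3]| = 6.
Proof. by rewrite cardsT card_Sn. Qed.

Lemma S3_isog_D6 : [set: 'S_3] \isog [set: 'D_6].
Proof.
have [x [y [ox oy ncxy]]] := S3_noncommuting_involutions.
exact: order6_isog_D6 (in_setT x) (in_setT y) ox oy ncxy card_S3.
Qed.

Lemma alpha_S3 : alpha [set: 'S_3]%G = (5%:R / 6%:R)%R.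
Proof.
have [x [y [ox oy ncxy]]] := S3_noncommuting_involutions.
exact: (order6_alpha (in_setT x) (in_setT y) ox oy ncxy card_S3).
Qed.

(** * Direct products with an elementary abelian 2-group *)

Lemma abelem_C2pow n : 2.-abelem [set: C2pow n].
Proof.
rewrite abelemE //; apply/andP; split.
  by apply/centsP=> u _ v _; apply/ffunP=> i; rewrite !ffunE Zp_mulgC.
apply/exponentP=> u _; apply/ffunP=> i; rewrite expgS expg1 !ffunE.
by case: (u i) => -[|[|]] //= ?; apply: val_inj.
Qed.

Lemma card_C2pow n : #|[set: C2pow n]| = (2 ^ n)%N.
Proof. by rewrite cardsT (card_ffun 'I_n 'Z_2) !card_ord. Qed.

Lemma abelem_isog_C2pow (gT : finGroupType) (G : {group gT}) :
  2.-abelem G -> exists n, G \isog [set: C2pow n].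
Proof.
move=> abG; exists (logn 2 #|G|).
rewrite (isog_abelem_card _ abG) abelem_C2pow card_C2pow.
by rewrite -(card_pgroup (abelem_pgroup abG)) eqxx.
Qed.

Lemma dprod_isog_setX_C2pow (gT rT : finGroupType) (G K D : {group gT})
    (L : {group rT}) :
  2.-abelem K -> K \x D = G -> D \isog L ->
  exists n, G \isog setX [set: C2pow n] L.
Proof.
move=> /abelem_isog_C2pow[n isoK] defG isoD; exists n.
apply: isog_dprod defG (setX_dprod _ _) _ _ => /=.
  exact: isog_trans isoK (isog_setX1 _ _).
exact: isog_trans isoD (isog_set1X _ _).
Qed.

(** * Involutions with a centraliser of index 3 or 2 *)

Section Cases.
Variables (gT : finGroupType) (G : {group gT}).
Implicit Types (x y : gT).

(** The index 3 turns [Ldiv2_card_cent1] into an equality, which puts [C] inside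
    ['Ldiv_2(G)] and leaves some [t] of ['Ldiv_2(G)] outside [C]. The
    involutions [x] and [x ^ t] then generate a copy of [S_3], and [G] is its
    direct product with [C :&: C :^ t]. *)
Lemma cent1_index3 x :
    (2 * #|G| <= 3 * #|'Ldiv_2(G)|)%N -> x \in 'Ldiv_2(G) ->
    #|G| = (3 * #|'C_G[x]|)%N ->
  (3 * #|'Ldiv_2(G)| = 2 * #|G|)%N /\
  exists n, G \isog setX [set: C2pow n] [set: 'S_3].
Proof.
move=> leGS Sx oG; have [Gx xV] := Ldiv2P _ _ Sx.
have oS : #|'Ldiv_2(G)| = (2 * #|'C_G[x]|)%N.
  by have := Ldiv2_card_cent1 Sx; move: leGS oG; card_lia.
split; first by move: oS oG; card_lia.
set C := 'C_G[x]%G; have sCG : C \subset G by exact: subsetIl.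
have posC : 0 < #|C| := cardG_gt0 C.
have Cx : x \in C by rewrite inE Gx cent1id.
have abC : 2.-abelem C.
  apply: Ldiv2_abelem.
  have -> : 'Ldiv_2(C) = C.
    apply/setIidPl; apply: subset_trans (subsetIr G _).
    by apply: Ldiv2_card_cent1_eq => //; move: oS oG; card_lia.
  by move: posC; card_lia.
have cCC := abelem_abelian abC.
have [t St nCt] : exists2 t, t \in 'Ldiv_2(G) & t \notin C.
  apply/subsetPn; apply: contraL posC => /subset_leq_card.
  by move: oS => /=; card_lia.
have [Gt tV] := Ldiv2P _ _ St.
have ot : #[t] = 2.
  by apply: (Ldiv2_order St); apply: contraNneq nCt => ->; apply: group1.
have CJ : C :^ t = 'C_G[x ^ t] by rewrite /= conjIg conjGid // cent1J.
(* If [x ^ t] were in the abelian group [C], then [C] would centralise it, hence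
   be equal to [C :^ t]; so [C <*> <[t]>] would be a subgroup of order
   [2 * #|C|], which is two thirds of [#|G|]. *)
have nCy : x ^ t \notin C.
  apply/negP => Cy.
  have nCT : <[t]> \subset 'N(C).
    rewrite cycle_subG; apply/normP/eqP.
    rewrite eq_sym eqEcard cardJg leqnn andbT CJ subsetI sCG sub_cent1.
    exact: subsetP cCC _ Cy.
  have eqM : C <*> <[t]> = G.
    apply: half_subG; first by rewrite join_subG sCG cycle_subG.
    have := card_proper_double (joing_subl C <[t]>) (mem_gen _) nCt.
    rewrite inE cycle_id orbT => /(_ isT).
    by move: posC oG => /=; card_lia.
  have := mul_cardG C <[t]>; rewrite -norm_joinEr // eqM.
  have := cardG_gt0 (C :&: <[t]>).
  rewrite -orderE ot => I0 E.
  have : (#|G| <= 2 * #|C|)%N by rewrite (mulnC 2) E leq_pmulr.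
  by move: posC oG => /=; card_lia.
set y := x ^ t in CJ nCy.
have Gy : y \in G by rewrite groupJ.
have ox : #[x] = 2.
  apply: (Ldiv2_order Sx); apply: contraNneq nCt => x1.
  by rewrite inE Gt x1; apply/cent1P; apply: commute1.
have oy : #[y] = 2 by rewrite orderJ.
have ncxy : x ^ y != x.
  apply: contra nCy => /eqP/conjg_fixP/commgP cxy.
  by rewrite inE Gy; apply/cent1P.
have nxy : x != y by apply: contraNneq nCy => <-.
have ncyx : y ^ x != y.
  apply: contra ncxy => /eqP/conjg_fixP/commgP cyx.
  exact/eqP/conjg_fixP/commgP/commute_sym.
(* Both sides differ from [x] and [y], and [x] has only three conjugates. *)
have braid : x ^ y = y ^ x.
  apply/eqP/negPn/negP=> nbraid.
  have : [set x; y; x ^ y; y ^ x] \subset x ^: G.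
    rewrite !subUset !sub1set class_refl !memJ_class //.
    by rewrite -conjgM memJ_class ?groupM.
  move/subset_leq_card; rewrite -index_cent1 -divgS // oG mulnK //.
  rewrite -!setUA !cardsU1 cards1 !inE (negPf nxy) /= ![_ == x ^ y]eq_sym.
  rewrite ![_ == y ^ x]eq_sym [_ == x ^ y]eq_sym (negPf nbraid).
  by rewrite !conjg_eq_r (negPf ncxy) (negPf ncyx) eq_sym (negPf nxy).
have oxy := braid_order3 ox oy braid ncxy.
have oD := card_gen_involutions ox oy ncxy.
set D := <<[set x; y]>>%G in oD.
set Z := (C :&: C :^ t)%G.
have sZC : Z \subset C by apply: subsetIl.
have cZx : Z \subset 'C[x] := subset_trans sZC (subsetIr _ _).
have cZy : Z \subset 'C[y] by rewrite /Z /= CJ setIA subsetIr.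
have nZx : x \notin Z.
  apply: contra ncxy => /(subsetP cZy)/cent1P cxy.
  exact/eqP/conjg_fixP/commgP.
(* [C * C :^ t] lies in [G], so [#|C : Z|] is at most 3; it is a power of 2. *)
have leCZ : (#|C| <= 2 * #|Z|)%N.
  have pC : 2.-nat #|C| by apply: abelem_pgroup abC.
  have le3 : #|C : Z| <= 3.
    rewrite -(leq_pmul2l (cardG_gt0 Z)) Lagrange // -(leq_pmul2l posC).
    have -> : (#|C| * #|C| = #|(C * C :^ t)%g| * #|Z|)%N.
      by rewrite -{2}(cardJg C t) mul_cardG.
    rewrite mulnCA mulnC leq_mul2l mulnC -oG.
    by rewrite subset_leq_card ?orbT // mul_subG // CJ subsetIl.
  have : #|C : Z| != 3.
    by apply: contraTneq pC => i3; rewrite -(Lagrange sZC) i3 pnatM andbC.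
  rewrite -(Lagrange sZC) mulnC leq_mul2r.
  by case: #|C : Z| le3 => [|[|[|[|]]]] //= *; rewrite orbT.
have ltGC : (#|G| < 4 * #|C|)%N by move: posC oG => /=; card_lia.
have [cDZ defG] := involutions_cent_mul sZC sCG Cx nZx Gy nCy cZx cZy leCZ ltGC.
(* [G] has order [6 * #|Z|], which is [#|Z| * #|D|]. *)
have TI : Z :&: D = 1.
  apply/eqP; rewrite trivg_card1 eqn_leq cardG_gt0 andbT.
  rewrite -(leq_pmul2l (cardG_gt0 G)) -{1}defG -mul_cardG oD oxy muln1.
  have := card_proper_double sZC Cx nZx.
  by move: oG leCZ => /=; card_lia.
have abZ : 2.-abelem Z by apply: abelemS abC.
have defGD : Z \x D = G by rewrite dprodE.
have isoD : D \isog [set: 'S_3].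
  apply: isog_trans (isog_symr S3_isog_D6).
  by have := involutions_gen_dihedral ox oy nxy; rewrite /= oD oxy.
exact: (dprod_isog_setX_C2pow abZ defGD isoD).
Qed.

(** For [t] in ['Ldiv_2(G)] outside [C], the product [x * t] is neither in [C]
    nor in ['Ldiv_2(G)]; so ['Ldiv_2(G)] contains at most half of [G :\: C] and
    at least 5/6 of [C], which is therefore elementary abelian. Any involution
    [y] outside [C] then generates a copy of [D_8] with [x]. *)
Lemma cent1_index2 x :
    (2 * #|G| <= 3 * #|'Ldiv_2(G)|)%N -> x \in 'Ldiv_2(G) ->
    #|G| = (2 * #|'C_G[x]|)%N ->
    {in 'Ldiv_2(G), forall y, #|G| <= 2 * #|'C_G[y]|}%N ->
  [/\ (4 * #|'Ldiv_2(G)| = 3 * #|G|)%N,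
      {in G, forall g, g ^+ 4 = 1}
    & exists n, G \isog setX [set: C2pow n] [set: 'D_8]].
Proof.
move=> leGS Sx oG leC; have [Gx xV] := Ldiv2P _ _ Sx.
set C := 'C_G[x]%G; have sCG : C \subset G by exact: subsetIl.
have {}oG : #|G| = (2 * #|C|)%N := oG.
have posC : 0 < #|C| := cardG_gt0 C.
have Cx : x \in C by rewrite inE Gx cent1id.
pose T := 'Ldiv_2(G) :\: C.
have leT : (2 * #|T| <= #|C|)%N.
  have TI : T :&: x *: T = set0.
    apply/setP=> t; rewrite inE [RHS]inE.
    apply/negP=> /andP[/setDP[St nCt] xTt].
    case/negP: nCt; apply: (subsetP (Ldiv2_lcoset Sx)).
    by rewrite inE St; apply: subsetP xTt; rewrite mulgS ?subsetDl.
  have sT : T :|: x *: T \subset G :\: C.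
    rewrite subUset setSD ?subsetIl //=; apply/subsetP=> t.
    case/lcosetP=> u /setDP[/LdivP[Gu _] nCu] ->.
    by rewrite inE groupMl // nCu groupM.
  have := subset_leq_card sT.
  rewrite cardsU TI cards0 subn0 card_lcoset cardsD (setIidPr sCG).
  by move: oG; card_lia.
have abC : 2.-abelem C.
  apply: Ldiv2_abelem.
  have -> : 'Ldiv_2(C) = 'Ldiv_2(G) :&: C by rewrite setIAC (setIidPr sCG).
  have := cardsID C 'Ldiv_2(G); rewrite -/T.
  by move: oG posC leGS leT; card_lia.
have cCC := abelem_abelian abC.
have sCS : C \subset 'Ldiv_2(G).
  by rewrite subsetI sCG sub_LdivT; move: abC; rewrite abelemE // => /andP[].
have [y Sy nCy] : exists2 y, y \in 'Ldiv_2(G) & y \notin C.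
  apply/subsetPn; apply: contraL posC => /subset_leq_card.
  by move: oG leGS; card_lia.
have [Gy yV] := Ldiv2P _ _ Sy.
have nxy : x != y by apply: contraNneq nCy => <-.
have ox : #[x] = 2.
  apply: (Ldiv2_order Sx); apply: contraNneq nCy => x1.
  by rewrite inE Gy x1; apply/cent1P; apply: commute1.
have oy : #[y] = 2.
  by apply: (Ldiv2_order Sy); apply: contraNneq nCy => ->; apply: group1.
have ncxy : x ^ y != x.
  apply: contra nCy => /eqP/conjg_fixP/commgP cxy.
  by rewrite inE Gy; apply/cent1P.
have nCG : C <| G.
  by apply: index2_normal; rewrite // -divgS // oG mulnK.
set Z := (C :&: 'C_G[y])%G.
have sZC : Z \subset C by apply: subsetIl.
have cZx : Z \subset 'C[x] := subset_trans sZC (subsetIr _ _).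
have cZy : Z \subset 'C[y] by rewrite /Z /= !setIA subsetIr.
have nZx : x \notin Z.
  apply: contra ncxy => /(subsetP cZy)/cent1P cxy.
  exact/eqP/conjg_fixP/commgP.
(* [C] and ['C_G[y]] have index at most 2, and their product lies in [G]. *)
have leCZ : (#|C| <= 2 * #|Z|)%N.
  rewrite -(leq_pmul2l (cardG_gt0 G)).
  apply: (@leq_trans (2 * #|'C_G[y]| * #|C|)).
    by rewrite leq_mul2r (leC y Sy) orbT.
  rewrite mulnCA -mulnA leq_mul2l /= mulnC mul_cardG leq_mul2r.
  by rewrite subset_leq_card ?orbT // mul_subG // subsetIl.
have ltGC : (#|G| < 4 * #|C|)%N by move: posC oG; card_lia.
have [cDZ defG] := involutions_cent_mul sZC sCG Cx nZx Gy nCy cZx cZy leCZ ltGC.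
have ge2C := card_proper_double sZC Cx nZx.
(* The quotient [G / C] has order 2 and [C] has exponent 2. *)
have expG : {in G, forall g, g ^+ 4 = 1}.
  move=> g Gg; rewrite (expgM g 2 2).
  have : g ^+ 2 \in 'Ldiv_2(G).
    apply: (subsetP sCS); have Ng := subsetP (normal_norm nCG) g Gg.
    have iC2 : #|G / C| = 2.
      by rewrite card_quotient ?normal_norm // -divgS // oG mulnK.
    apply: coset_idr; first exact: groupX.
    by rewrite morphX //= -iC2 expg_cardG // mem_quotient.
  by case/LdivP.
(* ['Ldiv_2(G)] contains the disjoint sets [C] and [y *: Z], that is 3/4 of [G];
   it cannot contain more, as [G] is not abelian. *)
have oS : (4 * #|'Ldiv_2(G)| = 3 * #|G|)%N.
  have leS : (#|C| + #|Z| <= #|'Ldiv_2(G)|)%N.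
    have TI : C :&: y *: Z = set0.
      apply/setP=> t; rewrite inE [RHS]inE; apply/negP=> /andP[Ct].
      case/lcosetP=> u Zu tE; case/negP: nCy.
      by rewrite -(groupMr _ (subsetP sZC u Zu)) -tE.
    have := cardsUI C (y *: Z); rewrite TI cards0 addn0 card_lcoset => <-.
    apply: subset_leq_card; rewrite subUset sCS; apply/subsetP=> t.
    case/lcosetP=> u Zu ->; have Su := subsetP sCS u (subsetP sZC u Zu).
    have /LdivP[_ yy] := Sy; have /LdivP[Gu uu] := Su.
    apply/LdivP; split; first exact: groupM.
    rewrite expgMn ?yy ?uu ?mulg1 //.
    exact/commute_sym/cent1P/(subsetP cZy).
  have geS : (4 * #|'Ldiv_2(G)| <= 3 * #|G|)%N.
    rewrite leqNgt; apply: contra ncxy => /Ldiv2_abelem/abelem_abelian cGG.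
    exact/eqP/conjg_fixP/commgP/(centsP cGG).
  by move: leS geS oG leCZ ge2C; card_lia.
split=> //.
(* Writing [(x * y) ^+ 2] as [x * x ^ y] displays it as an element of [C] whose
   two factors are exchanged by [y]. *)
pose z := x * x ^ y.
have zE : z = (x * y) ^+ 2 by rewrite /z conjgE yV expg2 !mulgA.
have Cxy : x ^ y \in C by rewrite memJ_norm // (subsetP (normal_norm nCG)).
have Zz : z \in Z.
  have Cz : z \in C by apply: groupM.
  apply/setIP; split=> //; apply/setIP; split; first exact: subsetP sCG z Cz.
  apply/cent1P/commgP/conjg_fixP.
  by rewrite /z conjMg -{3}yV conjgK; apply: (centsP cCC).
have ntz : z != 1.
  by apply: contra ncxy; rewrite -eq_invg_mul xV eq_sym.
have zz : z ^+ 2 = 1 by have /LdivP[] := subsetP sCS z (subsetP sZC z Zz).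
have oz : #[z] = 2 by apply: nt_prime_order.
have oxy : #[x * y] = 4.
  have : #[x * y] %| 4 by rewrite order_dvdn (expgM _ 2 2) -zE zz.
  have : ~~ (#[x * y] %| 2) by rewrite order_dvdn -zE.
  have := order_gt0 (x * y).
  by case: #[x * y] => [|[|[|[|[|n]]]]] // _ _ /dvdn_leq /(_ isT).
have oD := card_gen_involutions ox oy ncxy; rewrite oxy in oD.
set D := <<[set x; y]>>%G in oD.
have Dz : z \in D.
  by rewrite zE groupX // groupM // mem_gen // !inE eqxx ?orbT.
(* As [#|G| = 4 * #|Z|] and [#|D| = 8], the intersection has order 2. *)
have sZD : Z :&: D = <[z]>.
  apply/esym/eqP; rewrite eqEcard cycle_subG inE Zz Dz -orderE oz /=.
  rewrite -(leq_pmul2l (cardG_gt0 G)) -{1}defG -mul_cardG oD.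
  by move: oG leCZ ge2C; card_lia.
have abZ : 2.-abelem Z by apply: abelemS abC.
have [K defZ] : exists K : {group gT}, <[z]> \x K = Z.
  by apply: abelem_split_dprod abZ _; rewrite cycle_subG.
have [_ defZm cKz TIzK] := dprodP defZ.
have sKZ : K \subset Z by rewrite -defZm mulG_subr.
have defGD : K \x D = G.
  rewrite dprodE; last 2 first.
  - exact: subset_trans cDZ (centS sKZ).
  - by rewrite -(setIidPl sKZ) -setIA sZD setIC.
  rewrite -defG -defZm -(normC (cents_norm cKz)) -mulgA.
  by rewrite (mulSGid (H := <[z]>)) ?cycle_subG.
have isoD : D \isog [set: 'D_8].
  by have := involutions_gen_dihedral ox oy nxy; rewrite /= oD.
exact: (dprod_isog_setX_C2pow (abelemS sKZ abZ) defGD isoD).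
Qed.

End Cases.

(** * The classification *)

Theorem corollary2 (gT : finGroupType) (G : {group gT}) :
  alpha [set: 'S_3]%G = (5%:R / 6%:R)%R /\
  ((5%:R / 6%:R <= alpha G)%R ->
   [\/ exists n : nat, G \isog setX [set: C2pow n] [set: 'S_3]
         /\ alpha G = (5%:R / 6%:R)%R,
       exists n : nat, G \isog setX [set: C2pow n] 'D_8
         /\ alpha G = (7%:R / 8%:R)%R
     | exists n : nat, G \isog [set: C2pow n] /\ alpha G = 1%R]).
Proof.
split=> [|ge56]; first exact: alpha_S3.
have {}ge56 := alpha_ge (a := 5) (b := 6) isT ge56.
have lec := num_cyclic_le G.
have leGS : (2 * #|G| <= 3 * #|'Ldiv_2(G)|)%N.
  by move: ge56 lec; move: (num_cyclic G) => c; card_lia.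
have posG : 0 < #|G| := cardG_gt0 G.
have [SZ | /subsetPn[x Sx nZx]] := boolP ('Ldiv_2(G) \subset 'Z(G)).
  have abG : 2.-abelem G.
    by apply: Ldiv2_central_abelem SZ _; move: posG leGS; card_lia.
  have eG : {in G, forall g, g ^+ 2 = 1}.
    by move: abG; rewrite abelemE // => /andP[_ /exponentP].
  have SG : 'Ldiv_2(G) = G by apply/setIidPl/subsetP=> g Gg; rewrite inE eG.
  have [n isoG] := abelem_isog_C2pow abG.
  apply: Or33; exists n; split=> //.
  rewrite (alpha_eq (a := 1) (b := 1)) ?divr1 //.
  have phi2 : {in G, forall g, totient #[g] <= 2}.
    by move=> g /eG; apply: totient_order_le2.
  by have := num_cyclic_eq phi2; rewrite SG; lia.
have [Gx _] := Ldiv2P _ _ Sx.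
have le3 : forall y, y \in 'Ldiv_2(G) -> #|G : 'C_G[y]| <= 3.
  move=> y Sy; rewrite -(leq_pmul2l (cardG_gt0 'C_G[y])) Lagrange ?subsetIl //.
  by have := Ldiv2_card_cent1 Sy; move: leGS; card_lia.
have [/exists_inP[y Sy /eqP i3] | no3] :=
    boolP [exists y in 'Ldiv_2(G), #|G : 'C_G[y]| == 3].
  have oG : #|G| = (3 * #|'C_G[y]|)%N by rewrite -i3 mulnC Lagrange ?subsetIl.
  have [oS [n isoG]] := cent1_index3 leGS Sy oG.
  apply: Or31; exists n; split=> //; apply: alpha_eq => //.
  by move: ge56 lec oS; move: (num_cyclic G) => c; card_lia.
have le2 : {in 'Ldiv_2(G), forall y, #|G| <= 2 * #|'C_G[y]|}%N.
  move=> y Sy; rewrite -(Lagrange (subsetIl G 'C[y])) mulnC leq_mul2r.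
  have n3 : #|G : 'C_G[y]| != 3.
    by apply: contra no3 => i3; apply/exists_inP; exists y.
  by apply/orP; right; move: (le3 y Sy); rewrite leq_eqVlt (negPf n3).
have oG : #|G| = (2 * #|'C_G[x]|)%N.
  apply/eqP; rewrite eqn_leq le2 //=.
  have /subsetPn[g Gg nCg] : ~~ (G \subset 'C_G[x]).
    by apply: contra nZx; rewrite subsetI subxx sub_cent1 inE Gx.
  exact: card_proper_double (subsetIl _ _) Gg nCg.
have [oS exp4 [n isoG]] := cent1_index2 leGS Sx oG le2.
apply: Or32; exists n; split=> //; apply: alpha_eq => //.
have phi2 : {in G, forall g, totient #[g] <= 2}.
  by move=> g /exp4; apply: totient_order_le2.
by have := num_cyclic_eq phi2; move: oS; move: (num_cyclic G) => c; card_lia.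
Qed.
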